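(* Let $p$ be a prime, and let $x\in\mathbb{Z}(p^\infty)$ be a non-zero element. Then there is a Hausdorff group topology $\tau$ on $\mathbb{Z}(p^\infty)$ such that $\mathbf{n}(\mathbb{Z}(p^\infty),\tau)=\langle x\rangle$.
   Context: $\mathbb{Z}(p^\infty)$ is the Prüfer group, i.e., the subgroup of $\mathbb{Q}/\mathbb{Z}$ formed by the elements of $p$-power order; $\langle x\rangle$ is the cyclic subgroup generated by $x$. For a topological group $G$, the von Neumann radical $\mathbf{n}(G)$ is the kernel of the canonical map $\rho_G\colon G\to bG$ into the Bohr compactification (the universal continuous homomorphism into a compact Hausdorff group). For an abelian topological group $G$ one has $\mathbf{n}(G)=\bigcap_{\chi\in\hat G}\ker\chi$, where $\hat G$ is the group of all continuous homomorphisms $\chi\colon G\to\mathbb{T}=\mathbb{R}/\mathbb{Z}$. *)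

(* Defs.v *)
From HB Require Import structures.
From mathcomp Require Import all_boot all_order all_algebra ring_quotient.
From mathcomp Require Import all_classical all_reals all_analysis.

Set Implicit Arguments.
Unset Strict Implicit.
Unset Printing Implicit Defensive.

Import GRing.Theory.

Local Open Scope classical_set_scope.

HB.mixin Record isTopologicalGroup G & Topological G & Group G := {
  mulg_continuous : continuous (fun z : G * G => (z.1 * z.2)%g);
  invg_continuous : continuous (fun z : G => (z^-1)%g)
}.

#[short(type="topologicalGroupType")]
HB.structure Definition TopologicalGroup :=
  {G of Topological G & Group G & isTopologicalGroup G}.

Definition compact_hausdorff (K : topologicalType) : Prop :=
  compact [set: K] /\ hausdorff_space K.

Definition continuous_hom (G H : topologicalGroupType) (f : G -> H) : Prop :=
  {morph f : a b / (a * b)%g} /\ continuous f.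

Definition is_bohr_compactification (G B : topologicalGroupType)
    (rho : G -> B) : Prop :=
  [/\ compact_hausdorff B,
      continuous_hom rho &
      forall (K : topologicalGroupType) (f : G -> K),
        compact_hausdorff K -> continuous_hom f ->
        exists! g : B -> K, continuous_hom g /\ g \o rho = f].

(* The kernel of the canonical map of G into its Bohr compactification. The pair
   (B, rho) is unique up to a unique isomorphism, so the pairs quantified over
   below all have the same kernel. *)
Definition von_neumann_radical (G : topologicalGroupType) : set G :=
  [set a | forall (B : topologicalGroupType) (rho : G -> B),
     is_bohr_compactification rho -> rho a = 1%g].
Arguments von_neumann_radical : clear implicits.

Record topology (T : choiceType) := Topology {
  is_open : set_system T;
  is_openT : is_open [set: T];
  is_openI : setI_closed is_open;
  is_open_bigU : forall (I : Type) (A : I -> set T),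
    (forall i, is_open (A i)) -> is_open (\bigcup_i A i)
}.

(* The carrier T itself, equipped with t instead of any topology T may already
   carry. *)
Definition topologized (T : choiceType) (t : topology T) : Type := T.

HB.instance Definition _ (T : choiceType) (t : topology T) :=
  Choice.copy (topologized t) T.
HB.instance Definition _ (T : choiceType) (t : topology T) :=
  isOpenTopological.Build (topologized t)
    (@is_openT T t) (@is_openI T t) (@is_open_bigU T t).
HB.instance Definition _ (G : groupType) (t : topology G) :=
  Group.copy (topologized t) G.

Record group_topology (G : groupType) := GroupTopology {
  topology_of_group :> topology G;
  mul_continuous : continuous
    (fun z : topologized topology_of_group * topologized topology_of_group =>
       (z.1 * z.2)%g);
  inv_continuous : continuous
    (fun z : topologized topology_of_group => (z^-1)%g)
}.

Definition topologized_group (G : groupType) (tau : group_topology G) : Type :=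
  topologized tau.

HB.instance Definition _ (G : groupType) (tau : group_topology G) :=
  Topological.copy (topologized_group tau) (topologized tau).
HB.instance Definition _ (G : groupType) (tau : group_topology G) :=
  Group.copy (topologized_group tau) (topologized tau).
HB.instance Definition _ (G : groupType) (tau : group_topology G) :=
  isTopologicalGroup.Build (topologized_group tau)
    (@mul_continuous G tau) (@inv_continuous G tau).

Local Open Scope ring_scope.

Definition rat_int : {pred rat} := fun q => q \is a Num.int.

Lemma rat_int_zmod_closed : zmod_closed rat_int.
Proof. by split=> [|q r]; [exact: rpred0 | exact: rpredB]. Qed.

HB.instance Definition _ := GRing.isZmodClosed.Build rat rat_int
  rat_int_zmod_closed.

Definition rat_mod_int : zmodType := Quotient.quot (rat_int : zmodClosed rat).

Section Prufer.
Variable p : nat.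

(* For p prime, a *+ p ^ n = 0 for some n exactly when the order of a is a
   power of p. *)
Definition p_power_torsion : {pred rat_mod_int} :=
  fun a => `[< exists n : nat, a *+ (p ^ n)%N = 0 >].

Lemma p_power_torsion_zmod_closed : zmod_closed p_power_torsion.
Proof.
split=> [|a b /asboolP[m am] /asboolP[n bn]]; apply/asboolP.
  by exists 0%N; rewrite mul0rn.
exists (m + n)%N; rewrite expnD mulrnBl mulrnA am mul0rn sub0r.
by rewrite mulnC mulrnA bn mul0rn oppr0.
Qed.

HB.instance Definition _ :=
  GRing.isZmodClosed.Build rat_mod_int p_power_torsion
    p_power_torsion_zmod_closed.

Record prufer : Type := Prufer {
  prufer_val :> rat_mod_int;
  _ : prufer_val \in p_power_torsion
}.

HB.instance Definition _ := [isSub for prufer_val].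
HB.instance Definition _ := [Choice of prufer by <:].
HB.instance Definition _ := [SubChoice_isSubZmodule of prufer by <:].

End Prufer.

Definition cyclic_subgroup (V : zmodType) (x : V) : set V :=
  [set x *~ k | k in [set: int]].

(* Main.v *)
From HB Require Import structures.
Require Import Defs.
From mathcomp Require Import all_boot all_order all_algebra ring_quotient.
From mathcomp Require Import all_classical all_reals all_analysis.
From mathcomp Require Import zify ring lra.
From mathcomp Require Import Rstruct.

(** Let p ^ k be the order of x and let g_n be the class of the fraction
    1 / p ^ ((n + k) ^ 2) in Z(p^oo). The level of an index n is the exponent of
    2 in n, so there are infinitely many indices of each level. A relator of
    level l > 0 is an element
    [d = x + l g_b - (g_(a_1) + ... + g_(a_l))]
    where b and the distinct a_i have level l. The topology is given by the
    largest group seminorm for which every relator of level l has size at most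
    1/l: a neighbourhood of zero consists of the sums of c_j d_j, with c_j an
    integer and d_j a relator of level l_j, for which the sum of |c_j| / l_j is
    small. So relators of large level are close to zero.

    A continuous homomorphism f to a compact Hausdorff group kills x: the points
    f (g_n) with n of level l accumulate at some y, so b and the a_i can be
    chosen to make f d as close as desired to f x y^l y^-l = f x, while f d is
    close to 1 for large l (compact_image_relator, compact_image_radical).

    The topology is Hausdorff. Let a be a combination of relators that is killed
    by p ^ r and small depending on r. The orders of the g_n grow so fast that
    the largest n with a nonzero total coefficient would make the order of a
    exceed p ^ r, so every g_n has total coefficient 0 (coef_eq0). For n of
    level l this reads l H = T, with H and T the total coefficients of the
    relators in which n is the index b, respectively one of the a_i. As n is an
    a_i at most once in each relator, |T| is at most the number of relators of
    level l, counted with their coefficients; this number is less than l because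
    the combination is small, and hence H = 0. Summing H over all n shows that
    the coefficients c_j add up to 0, so x disappears as well and a = 0
    (combination_elt_eq0).

    Only the multiples of x are killed: multiplication by p ^ k followed by the
    inclusion in R/Z has kernel <x>, and it is continuous because p ^ k kills x
    and p ^ k g_n is very close to 0 in R/Z (char_continuous_hom).

    These facts determine the von Neumann radical because a Bohr
    compactification exists (bohr_compactificationP). It is obtained from the
    filters on the group that converge in every compact Hausdorff image, two
    filters being identified when they have the same limit in each of them. *)

Set Implicit Arguments.
Unset Strict Implicit.
Unset Printing Implicit Defensive.

Import Order.TTheory GRing.Theory Num.Theory.
Import numFieldNormedType.Exports.
Local Open Scope classical_set_scope.
Local Open Scope quotient_scope.

(** * Homomorphisms and limits in topological groups *)

Section ContinuousHom.
Variables (G K : topologicalGroupType) (f : G -> K).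
Hypothesis hf : continuous_hom f.

Lemma continuous_hom1 : f 1%g = 1%g.
Proof. by have [fM _] := hf; apply: (mulgI (f 1%g)); rewrite -fM !mulg1. Qed.

Lemma continuous_homV : {morph f : a / a^-1%g}.
Proof.
move=> a; apply/esym/mulg1_eq; have [fM _] := hf.
by rewrite -fM mulgV continuous_hom1.
Qed.

End ContinuousHom.

Lemma cvg_mulg (K : topologicalGroupType) (T : Type) (F : set_system T)
    (f g : T -> K) (a b : K) :
  Filter F -> f @ F --> a -> g @ F --> b ->
  (fun t => (f t * g t)%g) @ F --> (a * b)%g.
Proof.
move=> FF fa gb.
exact: (cvg_comp2 (h := fun x y : K => (x * y)%g) fa gb
  (@mulg_continuous K (a, b))).
Qed.

Lemma cvg_invg (K : topologicalGroupType) (T : Type) (F : set_system T)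
    (f : T -> K) (a : K) :
  Filter F -> f @ F --> a -> (fun t => (f t)^-1%g) @ F --> (a^-1)%g.
Proof. by move=> FF; apply: continuous_cvg; exact: invg_continuous. Qed.

Lemma cvg_expg (K : topologicalGroupType) (T : Type) (F : set_system T)
    (f : T -> K) (a : K) n :
  Filter F -> f @ F --> a -> (fun t => (f t ^+ n)%g) @ F --> (a ^+ n)%g.
Proof.
move=> FF fa; elim: n => [|n IHn]; first exact: cvg_cst.
rewrite expgSr.
have -> : (fun t => f t ^+ n.+1)%g = (fun t => f t ^+ n * f t)%g.
  by apply/funext => t; rewrite expgSr.
exact: cvg_mulg.
Qed.

(** * The Bohr compactification of a topological group *)

Section BohrCompactification.
Variable G : topologicalGroupType.

Definition compact_representation (K : topologicalGroupType) (f : G -> K) :=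
  compact_hausdorff K /\ continuous_hom f.

(** The points of the Bohr compactification are represented by these filters.
    All compact Hausdorff images are quantified over inside a proposition, so
    the filters form a type of the size of the power set of the power set of G
    and no set of representatives for the compact images has to be chosen. *)
Record bohr_filter := BohrFilter {
  bohr_sets :> set_system G;
  bohr_filter_proper : ProperFilter bohr_sets;
  bohr_filter_cvg : forall (K : topologicalGroupType) (f : G -> K),
    compact_representation f -> exists l : K, f @ bohr_sets --> l
}.
HB.instance Definition _ := gen_eqMixin bohr_filter.
HB.instance Definition _ := gen_choiceMixin bohr_filter.

Existing Instance bohr_filter_proper.

Definition filter_limit (K : topologicalGroupType) (f : G -> K)
    (F : set_system G) : K :=
  xget 1%g [set l : K | f @ F --> l].

Lemma filter_limitP (K : topologicalGroupType) (f : G -> K) (F : bohr_filter) :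
  compact_representation f -> f @ bohr_sets F --> filter_limit f F.
Proof. by move=> /(bohr_filter_cvg F) /(xgetPex 1%g). Qed.

Lemma filter_limitE (K : topologicalGroupType) (f : G -> K) (F : set_system G)
    (l : K) :
  compact_representation f -> ProperFilter F -> f @ F --> l ->
  filter_limit f F = l.
Proof.
move=> [[_ hK] _] PF Fl; apply: (cvg_unique hK _ Fl).
by apply: (xgetPex 1%g); exists l.
Qed.

Definition same_limits (E F : bohr_filter) : bool :=
  `[< forall (K : topologicalGroupType) (f : G -> K),
      compact_representation f -> filter_limit f E = filter_limit f F >].

Lemma same_limits_equiv : equiv_class_of same_limits.
Proof.
split=> [E|E F|F E H].
- exact/asboolP.
- by apply/asboolP/asboolP => EF K f Kf; rewrite EF.
- move=> /asboolP EF /asboolP FH; apply/asboolP => K f Kf.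
  by rewrite EF ?FH.
Qed.

Canonical same_limits_rel := EquivRelPack same_limits_equiv.

Definition bohr : Type := {eq_quot same_limits_rel}.
HB.instance Definition _ := Choice.copy bohr {eq_quot same_limits_rel}.

Definition bohr_class (F : bohr_filter) : bohr :=
  \pi_{eq_quot same_limits_rel} F.

Definition bohr_repr (b : bohr) : bohr_filter :=
  repr (b : {eq_quot same_limits_rel}).

Definition bohr_extension (K : topologicalGroupType) (f : G -> K) (b : bohr)
    : K :=
  filter_limit f (bohr_repr b).

Section Extension.
Variables (K : topologicalGroupType) (f : G -> K).
Hypothesis Kf : compact_representation f.

Lemma bohr_extension_cvg (b : bohr) :
  f @ bohr_sets (bohr_repr b) --> bohr_extension f b.
Proof. exact: filter_limitP. Qed.

Lemma bohr_extension_class (F : bohr_filter) (l : K) :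
  f @ bohr_sets F --> l -> bohr_extension f (bohr_class F) = l.
Proof.
move=> Fl; rewrite -(filter_limitE Kf (bohr_filter_proper F) Fl).
have /eqmodP/asboolP : repr (bohr_class F : {eq_quot same_limits_rel}) =
  F %[mod {eq_quot same_limits_rel}] by rewrite reprK.
by apply.
Qed.

End Extension.

Lemma bohr_eqP (b c : bohr) :
  (forall (K : topologicalGroupType) (f : G -> K),
    compact_representation f -> bohr_extension f b = bohr_extension f c) ->
  b = c.
Proof.
move=> bc.
rewrite -[b]/(b : {eq_quot same_limits_rel}) -[b]reprK -[c]reprK.
by apply/eqmodP/asboolP => K f Kf; apply: bc.
Qed.

(** A point of the compactification is determined by its image in every compact
    group, and a compatible family of images comes from a point as soon as one
    filter on G realizes all of them at once. The group operations and the
    limits of ultrafilters below are all obtained in this way. *)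
Lemma bohr_classP (F : set_system G)
    (l : forall (K : topologicalGroupType) (f : G -> K), K) :
  ProperFilter F ->
  (forall (K : topologicalGroupType) (f : G -> K),
    compact_representation f -> f @ F --> l K f) ->
  exists b : bohr, forall (K : topologicalGroupType) (f : G -> K),
    compact_representation f -> bohr_extension f b = l K f.
Proof.
move=> PF Fl.
have cvgF (K : topologicalGroupType) (f : G -> K) :
  compact_representation f -> exists l : K, f @ F --> l.
  by move=> Kf; exists (l K f); exact: Fl.
exists (bohr_class (BohrFilter PF cvgF)) => K f Kf.
by apply: bohr_extension_class => //=; exact: Fl.
Qed.

(** This turns out to be convergence in the topology defined next; see
    [bohr_cvgP]. *)
Definition bohr_converges (F : set_system bohr) (b : bohr) :=
  forall (K : topologicalGroupType) (f : G -> K),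
    compact_representation f -> bohr_extension f @ F --> bohr_extension f b.

(** The initial topology for all the maps to compact groups, described through
    convergence: with this definition the intersection of two open sets is open
    for free, whereas a base would require products of compact groups. *)
Definition bohr_open (A : set bohr) :=
  forall b, A b -> forall F : set_system bohr,
    ProperFilter F -> bohr_converges F b -> F A.

Lemma bohr_openT : bohr_open [set: bohr].
Proof. by move=> b _ F PF _; exact: filterT. Qed.

Lemma bohr_openI : setI_closed bohr_open.
Proof.
move=> A B oA oB b [Ab Bb] F PF Fb.
by apply: filterI; [exact: oA Fb|exact: oB Fb].
Qed.

Lemma bohr_open_bigU (I : Type) (A : I -> set bohr) :
  (forall i, bohr_open (A i)) -> bohr_open (\bigcup_i A i).
Proof.
move=> oA b [i _ Ab] F PF Fb; apply: filterS (oA i b Ab F PF Fb).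
exact: bigcup_sup.
Qed.

HB.instance Definition _ :=
  isOpenTopological.Build bohr bohr_openT bohr_openI bohr_open_bigU.

Lemma bohr_extension_continuous (K : topologicalGroupType) (f : G -> K) :
  compact_representation f -> continuous (bohr_extension f).
Proof.
move=> Kf; apply/continuousP => A oA.
change (bohr_open (bohr_extension f @^-1` A)) => b Ab F PF Fb.
by apply: Fb => //; exact: open_nbhs_nbhs.
Qed.

Lemma bohr_cvgP (F : set_system bohr) (b : bohr) :
  ProperFilter F -> F --> b <-> bohr_converges F b.
Proof.
move=> PF; split=> [Fb K f Kf|Fb A].
  by move=> A /(bohr_extension_continuous Kf)/Fb.
rewrite nbhsE => -[B [oB Bb] /filterS]; apply.
exact: (oB : bohr_open B) Bb F PF Fb.
Qed.

Lemma bohr_hausdorff : hausdorff_space bohr.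
Proof.
move=> b c bc; apply: bohr_eqP => K f Kf.
have [[_ hK] _] := Kf; apply: hK => A B Ab Bc.
have [d [Ad Bd]] := bc _ _ (bohr_extension_continuous Kf Ab)
  (bohr_extension_continuous Kf Bc).
by exists (bohr_extension f d).
Qed.

(** Given an ultrafilter F on the compactification, the subsets of G that belong
    to the filter representing F-almost every point form a filter on G; it has
    the same limits as F in all compact groups, so its class is a limit of F. *)
Lemma bohr_compact : compact [set: bohr].
Proof.
rewrite compact_ultra => F UF _.
have [b Fb] : exists b, bohr_converges F b.
  pose E : set_system G :=
    [set A | F [set b : bohr | bohr_sets (bohr_repr b) A]].
  have PE : ProperFilter E.
    apply: Build_ProperFilter_ex.
      by move=> A EA; have [b bA] := filter_ex (EA : F _); exact: filter_ex bA.
    split.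
    - by apply: (filterS (F := F)) filterT => b _; exact: filterT.
    - move=> A B EA EB; apply: (filterS2 (F := F)) EA EB => b.
      exact: filterI.
    - by move=> A B AB; apply: (filterS (F := F)) => b; exact: filterS.
  pose l (K : topologicalGroupType) (f : G -> K) :=
    xget 1%g [set l : K | bohr_extension f @ F --> l].
  have Fl (K : topologicalGroupType) (f : G -> K) :
    compact_representation f -> bohr_extension f @ F --> l K f.
    move=> [[cK _] _].
    have [k [_ Fk]] := cK (bohr_extension f @ F) _ (@filterT _ F _).
    suff kF : exists k : K, bohr_extension f @ F --> k.
      exact: (xgetPex 1%g kF).
    exists k => A Ak.
    have [//|FcA] := in_ultra_setVsetC (bohr_extension f @^-1` A) UF.
    by have [b []] := Fk (~` A) A FcA Ak.
  have El (K : topologicalGroupType) (f : G -> K) :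
    compact_representation f -> f @ E --> l K f.
    move=> Kf A.
    rewrite nbhsE => -[B [oB Bl] BA].
    have FB := Fl K f Kf B (open_nbhs_nbhs (conj oB Bl)).
    apply: (@filterS _ F _ _ _ _ FB) => b Bb.
    have := bohr_extension_cvg Kf (open_nbhs_nbhs (conj oB Bb)).
    by apply: filterS => a /BA.
  have [b bl] := bohr_classP PE El.
  by exists b => K f Kf; rewrite bl//; exact: Fl.
by exists b; split=> //; apply/bohr_cvgP.
Qed.

Lemma bohr_mul_ex (b c : bohr) : exists d : bohr,
  forall (K : topologicalGroupType) (f : G -> K), compact_representation f ->
    bohr_extension f d = (bohr_extension f b * bohr_extension f c)%g.
Proof.
pose Fb := bohr_sets (bohr_repr b).
pose Fc := bohr_sets (bohr_repr c).
apply: (bohr_classP (F := (fun z : G * G => (z.1 * z.2)%g) @ (Fb, Fc))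
  (l := fun K f => (bohr_extension f b * bohr_extension f c)%g)) => K f Kf.
rewrite -fmap_comp; have [_ [fM _]] := Kf.
have -> : f \o (fun z : G * G => (z.1 * z.2)%g) = fun z => (f z.1 * f z.2)%g.
  by apply/funext => z /=; rewrite fM.
apply: cvg_mulg.
  exact: (cvg_comp _ _ cvg_fst (bohr_extension_cvg (b := b) Kf)).
exact: (cvg_comp _ _ cvg_snd (bohr_extension_cvg (b := c) Kf)).
Qed.

Lemma bohr_inv_ex (b : bohr) : exists d : bohr,
  forall (K : topologicalGroupType) (f : G -> K), compact_representation f ->
    bohr_extension f d = (bohr_extension f b)^-1%g.
Proof.
pose Fb := bohr_sets (bohr_repr b).
apply: (bohr_classP (F := (fun z : G => z^-1%g) @ Fb)
  (l := fun K f => (bohr_extension f b)^-1%g)) => K f Kf.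
rewrite -fmap_comp; have [_ hf] := Kf.
have -> : f \o (fun z : G => z^-1%g) = (fun z => (z^-1)%g) \o f.
  by apply/funext => z /=; rewrite (continuous_homV hf).
by apply: cvg_invg; exact: bohr_extension_cvg.
Qed.

Lemma bohr_point_ex (a : G) : exists d : bohr,
  forall (K : topologicalGroupType) (f : G -> K), compact_representation f ->
    bohr_extension f d = f a.
Proof.
have PF : ProperFilter (principal_filter a).
  exact/ultra_proper/principal_filter_ultra.
apply: (bohr_classP (F := principal_filter a) (l := fun K f => f a)).
move=> K f Kf A /nbhs_singleton Afa.
exact/principal_filterP.
Qed.

Definition bohr_mul b c := sval (cid (bohr_mul_ex b c)).
Definition bohr_inv b := sval (cid (bohr_inv_ex b)).
Definition bohr_point a := sval (cid (bohr_point_ex a)).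

Lemma bohr_extensionM (K : topologicalGroupType) (f : G -> K) b c :
  compact_representation f -> bohr_extension f (bohr_mul b c) =
    (bohr_extension f b * bohr_extension f c)%g.
Proof. exact: (svalP (cid (bohr_mul_ex b c))). Qed.

Lemma bohr_extensionV (K : topologicalGroupType) (f : G -> K) b :
  compact_representation f ->
  bohr_extension f (bohr_inv b) = (bohr_extension f b)^-1%g.
Proof. exact: (svalP (cid (bohr_inv_ex b))). Qed.

Lemma bohr_extension_point (K : topologicalGroupType) (f : G -> K) a :
  compact_representation f -> bohr_extension f (bohr_point a) = f a.
Proof. exact: (svalP (cid (bohr_point_ex a))). Qed.

Lemma bohr_mulA : associative bohr_mul.
Proof.
by move=> a b c; apply: bohr_eqP => K f Kf; rewrite !bohr_extensionM// mulgA.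
Qed.

Lemma bohr_mul1 : left_id (bohr_point 1%g) bohr_mul.
Proof.
move=> b; apply: bohr_eqP => K f Kf; have [_ hf] := Kf.
by rewrite bohr_extensionM// bohr_extension_point// (continuous_hom1 hf) mul1g.
Qed.

Lemma bohr_mulr1 : right_id (bohr_point 1%g) bohr_mul.
Proof.
move=> b; apply: bohr_eqP => K f Kf; have [_ hf] := Kf.
by rewrite bohr_extensionM// bohr_extension_point// (continuous_hom1 hf) mulg1.
Qed.

Lemma bohr_mulV : left_inverse (bohr_point 1%g) bohr_inv bohr_mul.
Proof.
move=> b; apply: bohr_eqP => K f Kf; have [_ hf] := Kf.
rewrite bohr_extensionM// bohr_extensionV//.
by rewrite bohr_extension_point// (continuous_hom1 hf) mulVg.
Qed.

Lemma bohr_mulrV : right_inverse (bohr_point 1%g) bohr_inv bohr_mul.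
Proof.
move=> b; apply: bohr_eqP => K f Kf; have [_ hf] := Kf.
rewrite bohr_extensionM// bohr_extensionV//.
by rewrite bohr_extension_point// (continuous_hom1 hf) mulgV.
Qed.

HB.instance Definition _ :=
  isGroup.Build bohr bohr_mulA bohr_mul1 bohr_mulr1 bohr_mulV bohr_mulrV.

Lemma bohr_continuous (T : topologicalType) (h : T -> bohr) :
  (forall (K : topologicalGroupType) (f : G -> K),
    compact_representation f -> continuous (bohr_extension f \o h)) ->
  continuous h.
Proof.
move=> hc t; apply/bohr_cvgP => K f Kf.
by rewrite -fmap_comp; exact: hc.
Qed.

Lemma bohr_mul_continuous : continuous (fun z : bohr * bohr => (z.1 * z.2)%g).
Proof.
apply: bohr_continuous => K f Kf [b c].
have -> : bohr_extension f \o (fun z : bohr * bohr => (z.1 * z.2)%g) =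
  fun z => (bohr_extension f z.1 * bohr_extension f z.2)%g.
  by apply/funext => w /=; exact: bohr_extensionM.
have cf := bohr_extension_continuous Kf.
apply: cvg_mulg.
  apply: (@cvg_comp _ _ _ fst (bohr_extension f)); last exact: cf.
  exact: cvg_fst.
apply: (@cvg_comp _ _ _ snd (bohr_extension f)); last exact: cf.
exact: cvg_snd.
Qed.

Lemma bohr_inv_continuous : continuous (fun z : bohr => (z^-1)%g).
Proof.
apply: bohr_continuous => K f Kf z.
have -> : bohr_extension f \o (fun z : bohr => (z^-1)%g) =
  (fun z => (z^-1)%g) \o bohr_extension f.
  by apply/funext => w /=; exact: bohr_extensionV.
apply: (@cvg_invg _ _ (nbhs z) (bohr_extension f)).
exact: bohr_extension_continuous.
Qed.

HB.instance Definition _ :=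
  isTopologicalGroup.Build bohr bohr_mul_continuous bohr_inv_continuous.

(** Extensions are unique because every point of the compactification is the
    limit of the image of the filter on G that represents it. *)
Theorem bohr_compactificationP : is_bohr_compactification bohr_point.
Proof.
split.
- by split; [exact: bohr_compact|exact: bohr_hausdorff].
- split=> [a b|].
    apply: bohr_eqP => K f Kf; have [_ [fM _]] := Kf.
    by rewrite bohr_extensionM// !bohr_extension_point.
  apply: bohr_continuous => K f Kf; have [_ [_ cf]] := Kf.
  suff -> : bohr_extension f \o bohr_point = f by [].
  by apply/funext => a; exact: bohr_extension_point.
- move=> K f cK hf; have Kf : compact_representation f by [].
  exists (bohr_extension f); split.
    split; last by apply/funext => a; exact: bohr_extension_point.
    split; last exact: bohr_extension_continuous.
    by move=> b c; exact: bohr_extensionM.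
  move=> g [[_ cg] gf]; apply/funext => b.
  pose F := bohr_sets (bohr_repr b).
  have Fb : bohr_point @ F --> b.
    apply/bohr_cvgP => L h Lh; rewrite -fmap_comp.
    suff -> : bohr_extension h \o bohr_point = h by exact: bohr_extension_cvg.
    by apply/funext => a; exact: bohr_extension_point.
  have [_ hK] := cK; apply: (cvg_unique hK (bohr_extension_cvg (b := b) Kf)).
  by rewrite -gf fmap_comp; apply: cvg_trans (cg b); exact: cvg_app Fb.
Qed.
End BohrCompactification.

(** * Group topologies from a neighbourhood base at zero *)

Section BaseTopology.
Local Open Scope ring_scope.
Variables (V : zmodType) (U : nat -> set V).

Definition group_base :=
  [/\ forall n, U n 0, forall n a, U n a -> U n (- a) &
      forall n a b, U n.+1 a -> U n.+1 b -> U n (a + b)].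

Hypothesis baseU : group_base.

Lemma group_base_decr m n a : (m <= n)%N -> U n a -> U m a.
Proof.
have [U0 _ UD] := baseU.
elim: n => [|n IHn]; first by rewrite leqn0 => /eqP->.
rewrite leq_eqVlt => /predU1P[->//|mn] Ua; apply: IHn => //.
by rewrite -[a]addr0; apply: UD.
Qed.

Local Notation G := (Algebra.to_multiplicative V).

Definition base_open (A : set G) :=
  forall a : V, A a -> exists n, forall u, U n u -> A (a + u).

Lemma base_openT : base_open [set: G].
Proof. by move=> a _; exists 0%N. Qed.

Lemma base_openI : setI_closed base_open.
Proof.
move=> A B oA oB a [/oA[m Am] /oB[n Bn]].
exists (maxn m n) => u Uu; split.
- by apply/Am/(group_base_decr (leq_maxl m n)).
- by apply/Bn/(group_base_decr (leq_maxr m n)).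
Qed.

Lemma base_open_bigU (I : Type) (A : I -> set G) :
  (forall i, base_open (A i)) -> base_open (\bigcup_i A i).
Proof.
by move=> oA a [i _ /oA[n An]]; exists n => u Uu; exists i => //; exact: An.
Qed.

Definition base_topology : topology G :=
  Topology base_openT base_openI base_open_bigU.

Lemma base_nbhsP (a : V) (A : set V) :
  nbhs (a : topologized base_topology) A <->
  exists n, forall u, U n u -> A (a + u).
Proof.
have [U0 _ UD] := baseU.
split=> [|[n An]].
  rewrite nbhsE => -[B [oB Ba] BA].
  by have [n Bn] := (oB : base_open B) a Ba; exists n => u /Bn/BA.
rewrite nbhsE.
exists [set b | exists m, forall u, U m u -> A (b + u)].
  split; last by exists n.
  change (base_open [set b | exists m, forall u, U m u -> A (b + u)]).
  move=> b [m Am]; exists m.+1 => u Uu; exists m.+1 => v Uv.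
  by rewrite -addrA; apply/Am/UD.
by move=> b [m Am]; rewrite -[b]addr0; apply: Am.
Qed.

Lemma base_mul_continuous : continuous
  (fun z : topologized base_topology * topologized base_topology =>
     (z.1 * z.2)%g).
Proof.
have [_ _ UD] := baseU.
move=> [a b] A /base_nbhsP[n An].
exists ([set c | U n.+1 (c - a)], [set c | U n.+1 (c - b)]) => /=.
  by split; apply/base_nbhsP; exists n.+1 => u Uu /=; rewrite addrC addKr.
move=> [c d] [/= Uc Ud].
have -> : (c * d)%g = a + b + ((c - a) + (d - b)) :> V.
  by rewrite addrACA !(addrC _ (_ - _)) !subrK.
exact/An/UD.
Qed.

Lemma base_inv_continuous :
  continuous (fun z : topologized base_topology => (z^-1)%g).
Proof.
have [_ UN _] := baseU.
move=> a A /base_nbhsP[n An]; apply/base_nbhsP; exists n => u Uu.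
change (A (- ((a : V) + u))); rewrite opprD; exact/An/UN.
Qed.

Definition base_group_topology : group_topology G :=
  GroupTopology base_mul_continuous base_inv_continuous.

Lemma base_hausdorff : (forall a, (forall n, U n a) -> a = 0) ->
  hausdorff_space (topologized_group base_group_topology).
Proof.
have [_ UN UD] := baseU.
move=> U0 a b ab; apply/eqP; rewrite eq_sym -(@subr_eq0 V); apply/eqP/U0 => n.
have [||c [Uac Ubc]] :=
    ab [set c : V | U n.+1 (c - a)] [set c : V | U n.+1 (c - b)].
- by apply/base_nbhsP; exists n.+1 => u Uu /=; rewrite addrC addKr.
- by apply/base_nbhsP; exists n.+1 => u Uu /=; rewrite addrC addKr.
- rewrite -(subrKA (c : V)) -[(b : V) - c]opprB; apply: UD => //; exact: UN.
Qed.

End BaseTopology.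

Section BaseHom.
Local Open Scope ring_scope.
Variables (V W : zmodType) (U : nat -> set V) (U' : nat -> set W).
Hypotheses (baseU : group_base U) (baseU' : group_base U').

Lemma base_continuous_hom (f : V -> W) :
  {morph f : a b / a + b} ->
  (forall n, exists m, forall a, U m a -> U' n (f a)) ->
  @continuous_hom (topologized_group (base_group_topology baseU))
    (topologized_group (base_group_topology baseU')) f.
Proof.
move=> fD fc; split=> // a A /base_nbhsP[n An].
apply/base_nbhsP; have [m Um] := fc n; exists m => u /Um/An.
by rewrite -fD.
Qed.

End BaseHom.

(** * The circle group *)

Section Quot.
Local Open Scope ring_scope.
Variables (V : zmodType) (I : zmodClosed V).

Lemma quot_piD (a b : V) :
  \pi_(Quotient.quot I) (a + b) = \pi a + \pi b.
Proof. by rewrite raddfD. Qed.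

Lemma quot_pi_eq (a b : V) :
  \pi_(Quotient.quot I) a = \pi b <-> a - b \in I.
Proof. by rewrite Quotient.idealrBE; split=> [->|/eqP]. Qed.

Lemma quot_pi_eq0 (a : V) : \pi_(Quotient.quot I) a = 0 <-> a \in I.
Proof. by rewrite -[0](raddf0 \pi_(Quotient.quot I)) quot_pi_eq subr0. Qed.
End Quot.

Lemma half_exp_lt (R : archiRealFieldType) (e : R) :
  (0 < e)%R -> exists n, (2^-1 ^+ n < e)%R.
Proof.
move=> e0; exists (Num.bound e^-1); rewrite exprVn invf_plt ?posrE ?exprn_gt0//.
rewrite (lt_trans (archi_boundP _)) ?invr_ge0 ?ltW// -natrX ltr_nat.
exact: ltn_expl.
Qed.

Section Circle.
Local Open Scope ring_scope.
Variable R : realType.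

Definition real_int : {pred R} := fun t => t \is a Num.int.

Lemma real_int_zmod_closed : zmod_closed real_int.
Proof. by split=> [|s t]; [exact: rpred0|exact: rpredB]. Qed.

HB.instance Definition _ := GRing.isZmodClosed.Build R real_int
  real_int_zmod_closed.

Definition circle : zmodType := Quotient.quot (real_int : zmodClosed R).

Definition circle_ball (n : nat) : set circle :=
  [set c | exists2 t : R, `|t| < 2^-1 ^+ n & c = \pi_circle t].

Lemma circle_ball_base : group_base circle_ball.
Proof.
split=> [n|n _ [t tn ->]|n _ _ [s sn ->] [t tn ->]].
- exists 0; first by rewrite normr0 exprn_gt0.
  by rewrite raddf0.
- by exists (- t); rewrite ?normrN// raddfN.
- exists (s + t); last by rewrite raddfD.
  rewrite (le_lt_trans (ler_normD _ _))//.
  have -> : (2^-1 : R) ^+ n = 2^-1 ^+ n.+1 + 2^-1 ^+ n.+1.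
    by rewrite exprS; lra.
  exact: ltrD.
Qed.

Definition circle_group : topologicalGroupType :=
  topologized_group (base_group_topology circle_ball_base).

Lemma circle_pi_continuous : continuous (\pi_circle : R -> circle_group).
Proof.
move=> t A /base_nbhsP[n An].
apply/nbhs_ballP; exists (2^-1 ^+ n) => /=; first exact: exprn_gt0.
move=> s; rewrite /ball /= => ts.
rewrite -(subrKC t s) quot_piD; apply: An; exists (s - t) => //.
by rewrite distrC.
Qed.

(** If t is not an integer, its distance to the integers is the positive number
    e below, and the class of t is not in a ball of radius at most e. *)
Lemma circle_hausdorff : hausdorff_space circle_group.
Proof.
apply: base_hausdorff => c c0; rewrite -[c]reprK.
set t := repr c; apply/quot_pi_eq0.
pose f := t - (Num.floor t)%:~R.
have f_itv : 0 <= f < 1 by rewrite /f; have := floor_itv t; lra.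
have [f0|f0] := eqVneq f 0.
  by rewrite (_ : t = (Num.floor t)%:~R) ?intr_int//; move: f0; rewrite /f; lra.
pose e := Num.min f (1 - f).
have e0 : 0 < e by rewrite lt_min; lra.
have [n ne] := half_exp_lt e0.
have [s sn cs] := c0 n.
have /intrP[z tz] : t - s \in real_int by apply/quot_pi_eq; rewrite reprK.
have zf : `|f - (z - Num.floor t)%:~R| < e.
  by rewrite (_ : f - _ = s) ?(lt_trans sn)// rmorphB /= -tz /f; ring.
have [m0|m1] := lerP (z - Num.floor t) 0.
  have : ((z - Num.floor t)%:~R : R) <= 0 by rewrite lerz0.
  by move: zf f_itv; rewrite lt_min !ltr_norml; lra.
have : (1 : R) <= (z - Num.floor t)%:~R by rewrite ler1z.
by move: zf f_itv; rewrite lt_min !ltr_norml; lra.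
Qed.

(** The circle is the image of the unit interval. *)
Lemma circle_compact : compact [set: circle_group].
Proof.
have -> : [set: circle_group] = (\pi_circle : R -> circle_group) @` `[0, 1].
  apply/seteqP; split=> // c _; exists (repr c - (Num.floor (repr c))%:~R).
    by rewrite /= in_itv /=; have := floor_itv (repr c); lra.
  rewrite -[RHS]reprK; apply/quot_pi_eq.
  by rewrite addrAC subrr sub0r rpredN intr_int.
apply: continuous_compact; last exact: segment_compact.
by apply: continuous_subspaceT => t; exact: circle_pi_continuous.
Qed.
End Circle.

(** * The Prufer group and its characters *)

Lemma rat_intE (q : rat) : (q \in rat_int) = (q \is a Num.int).
Proof. by []. Qed.

Section PruferGroup.
Local Open Scope ring_scope.
Variable p : nat.
Hypothesis p_prime : prime p.

Let p_gt0 : (0 < p)%N. Proof. exact: prime_gt0. Qed.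

Let pX_neq0 (F : numDomainType) n : (p%:R ^+ n != 0 :> F).
Proof. by rewrite expf_neq0// pnatr_eq0 -lt0n. Qed.

Let mulr_p_expn (a : rat) n : a *+ p ^ n = a * p%:R ^+ n.
Proof. by rewrite -natrX mulr_natr. Qed.

Lemma prufer_gen_subproof h :
  \pi_rat_mod_int ((p%:R ^+ h)^-1 : rat) \in p_power_torsion p.
Proof.
apply/asboolP; exists h; rewrite -raddfMn; apply/quot_pi_eq0.
by rewrite mulr_p_expn mulVf ?pX_neq0// rat_intE rpred1.
Qed.

Definition prufer_gen h : prufer p := Prufer (prufer_gen_subproof h).

Lemma prufer_torsion (a : prufer p) : exists n, a *+ p ^ n = 0.
Proof.
have /asboolP[n an] := valP a; exists n; apply: val_inj.
by rewrite raddfMn.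
Qed.

Lemma prufer_genMn i j : prufer_gen (i + j) *+ p ^ i = prufer_gen j.
Proof.
apply: val_inj; rewrite raddfMn /= -raddfMn; congr (\pi _).
by rewrite mulr_p_expn exprD invfM mulrAC mulVf ?pX_neq0 ?mul1r.
Qed.

Lemma prufer_eq0 (a : prufer p) (m : nat) :
  a *+ m = 0 <-> repr (val a) *+ m \is a Num.int.
Proof.
have pi_a : \pi_rat_mod_int (repr (val a) *+ m) = val (a *+ m).
  by rewrite !raddfMn /= reprK.
rewrite -rat_intE -quot_pi_eq0 pi_a; split=> [->|am0]; first by rewrite raddf0.
by apply: val_inj; rewrite am0 raddf0.
Qed.

Lemma prufer_gen_eq0 h (z : int) :
  prufer_gen h *~ z = 0 <-> ((p ^ h)%N %| z)%Z.
Proof.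
have pi_z : \pi_rat_mod_int ((p%:R ^+ h)^-1 * z%:~R) = val (prufer_gen h *~ z).
  by rewrite mulrzr !raddfMz.
have -> : prufer_gen h *~ z = 0 <->
    (p%:R ^+ h)^-1 * z%:~R \is a @Num.int rat.
  rewrite -rat_intE -quot_pi_eq0 pi_z; split=> [->|gz0].
    by rewrite raddf0.
  by apply: val_inj; rewrite gz0 raddf0.
split=> [/intrP[m zm]|/dvdzP[m ->]].
  apply/dvdzP; exists m; apply: (@intr_inj rat).
  by rewrite rmorphM /= -zm -pmulrn natrX mulrAC mulVf ?pX_neq0// mul1r.
by rewrite rmorphM /= -pmulrn natrX mulrCA mulVf ?pX_neq0// mulr1 intr_int.
Qed.

Lemma prufer_genP (a : prufer p) r : a *+ p ^ r = 0 ->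
  exists z, a = prufer_gen r *~ z.
Proof.
move=> /prufer_eq0/intrP[z az]; exists z; apply: val_inj.
rewrite raddfMz /= -(raddfMz \pi_(Quotient.quot rat_int)) -[LHS]reprK.
congr (\pi _); rewrite -mulrzr -az mulr_p_expn mulrC.
by rewrite mulfK ?pX_neq0.
Qed.

(** The elements killed by p ^ r are the multiples of the class of 1 / p ^ r,
    and x is such a multiple by an integer prime to p. *)
Lemma prufer_cyclic_subgroup (x : prufer p) r :
  x *+ p ^ r = 0 -> x *+ p ^ r.-1 != 0 ->
  cyclic_subgroup x = [set a | a *+ p ^ r = 0].
Proof.
move=> xr xr1; apply/seteqP; split=> [_ [k _ <-]|a ar].
  by rewrite /= pmulrn mulrzAC -pmulrn xr mul0rz.
have [u xu] := prufer_genP xr; have [v av] := prufer_genP ar.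
have r0 : (0 < r)%N by case: r xr xr1 {xu ar av} => //= -> /eqP.
have pu : coprimez u (p ^ r)%N.
  rewrite coprimezE /= coprime_sym coprimeXl// prime_coprime//.
  apply: contraNN xr1 => /dvdnP[w uw].
  have /dvdzP[w' uw'] : (p %| u)%Z by rewrite dvdzE uw dvdn_mull.
  rewrite xu uw' pmulrn -mulrzA; apply/eqP/prufer_gen_eq0.
  by rewrite -mulrA -PoszM -expnS prednK// dvdz_mull.
have [s [t st]] : exists s t : int, s * u + t * (p ^ r)%N = 1.
  have [s [t st]] := Bezoutz u (p ^ r)%N.
  by exists s, t; rewrite st; move/eqP: pu.
exists (s * v) => //; rewrite av xu -mulrzA.
have vE : v = u * (s * v) + t * v * (p ^ r)%N by rewrite -[LHS]mul1r -st; ring.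
rewrite [in RHS]vE mulrzDr (prufer_gen_eq0 r (t * v * (p ^ r)%N)).2 ?addr0//.
exact: dvdz_mull.
Qed.

End PruferGroup.

Section CircleCharacter.
Local Open Scope ring_scope.
Variables (R : realType) (p k : nat).

Lemma real_int_ratr (q : rat) : (ratr q \in @real_int R) = (q \is a Num.int).
Proof.
apply/idP/idP => [/intrP[z qz]|/intrP[z ->]]; last first.
  by rewrite ratr_int; apply/intrP; exists z.
apply/intrP; exists z; apply: (fmorph_inj (@ratr R)).
by rewrite /= ratr_int.
Qed.

(** The inclusion of Z(p^oo) in R/Z composed with multiplication by p ^ k. *)
Definition circle_char (a : prufer p) : circle R :=
  \pi_(circle R) (ratr (repr (val a) *+ p ^ k)).

Lemma circle_charE (a : prufer p) (q : rat) : val a = \pi_rat_mod_int q ->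
  circle_char a = \pi_(circle R) (ratr (q *+ p ^ k)).
Proof.
move=> aq; apply/quot_pi_eq.
rewrite -rmorphB real_int_ratr -mulrnBl rpredMn//.
by rewrite -rat_intE -quot_pi_eq reprK.
Qed.

Lemma circle_charD : {morph circle_char : a b / a + b}.
Proof.
move=> a b; rewrite (@circle_charE _ (repr (val a) + repr (val b))).
  by rewrite mulrnDl rmorphD quot_piD.
by rewrite quot_piD !reprK raddfD.
Qed.

Lemma circle_char_eq0 (a : prufer p) : circle_char a = 0 <-> a *+ p ^ k = 0.
Proof. by rewrite quot_pi_eq0 real_int_ratr prufer_eq0. Qed.

HB.instance Definition _ := GRing.isNmodMorphism.Build (prufer p) (circle R)
  circle_char ((circle_char_eq0 0).2 (mul0rn _ _), circle_charD).

Lemma circle_char_gen (p_prime : prime p) h :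
  circle_char (prufer_gen p_prime h) = \pi_(circle R) (p%:R ^+ k / p%:R ^+ h).
Proof.
rewrite (@circle_charE _ (p%:R ^+ h)^-1)//; congr (\pi _).
by rewrite rmorphMn /= fmorphV rmorphXn /= rmorph_nat -[LHS]mulr_natl natrX.
Qed.

End CircleCharacter.

(** * The Hausdorff group topology *)

Section Combinatorics.
Local Open Scope ring_scope.
Variables (R : realType) (p : nat) (p_prime : prime p).
Variables (x : prufer p) (k : nat).
Hypotheses (xk : x *+ p ^ k = 0) (k_gt0 : (0 < k)%N).

Let p_gt1 : (1 < p)%N. Proof. exact: prime_gt1. Qed.

(** What matters is that every level is infinite and that the level of n is at
    most n. *)
Definition level (n : nat) : nat := logn 2 n.

Lemma level_le n : (level n <= n)%N.
Proof. by case: n => [//|n]; apply/ltnW/ltn_logl. Qed.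

(** The gaps between consecutive squares make the order of g_n large compared
    with the orders of all the previous g_i, and with the coefficients that g_n
    may get (see [height_gap]). *)
Definition height (n : nat) : nat := ((n + k) ^ 2)%N.

Definition spike (n : nat) : prufer p := prufer_gen p_prime (height n).

(** The pair of b and the list of the a_i. *)
Definition relator := (nat * seq nat)%type.

Definition relator_valid (j : relator) :=
  [&& (0 < level j.1)%N, uniq j.2, size j.2 == level j.1 &
      all (fun a => level a == level j.1) j.2].

Definition relator_elt (j : relator) : prufer p :=
  x + spike j.1 *+ level j.1 - \sum_(a <- j.2) spike a.

Definition combination := seq (int * relator).

Definition combination_valid (s : combination) :=
  all (fun z => relator_valid z.2) s.

Definition combination_elt (s : combination) : prufer p :=
  \sum_(z <- s) relator_elt z.2 *~ z.1.

Definition cost (s : combination) : R :=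
  \sum_(z <- s) `|z.1|%:~R / (level z.2.1)%:R.

Definition cost_ball (r : nat) : set (prufer p) :=
  [set v | exists s, [/\ combination_valid s, cost s < 2^-1 ^+ r &
                         v = combination_elt s]].

Lemma cost_ball_base : group_base cost_ball.
Proof.
split=> [r|r _ [s [vs cs ->]]|r _ _ [s [vs cs ->]] [t [vt ct ->]]].
- exists [::]; split=> //; first by rewrite /cost big_nil exprn_gt0.
  by rewrite /combination_elt big_nil.
- exists [seq (- z.1, z.2) | z <- s]; split.
  + by rewrite /combination_valid all_map.
  + by rewrite /cost big_map; under eq_bigr do rewrite /= normrN.
  + rewrite /combination_elt big_map -sumrN.
    by apply: eq_bigr => z _; rewrite mulrNz.
- exists (s ++ t); split.
  + by rewrite /combination_valid all_cat; apply/andP.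
  + rewrite /cost big_cat /=.
    have -> : (2^-1 : R) ^+ r = 2^-1 ^+ r.+1 + 2^-1 ^+ r.+1.
      by rewrite exprS; lra.
    exact: ltrD.
  + by rewrite /combination_elt big_cat.
Qed.

(** [head_coef s n] and [tail_coef s n] collect the coefficients of the relators
    in which n is the index b, respectively one of the a_i. *)
Definition head_coef (s : combination) (n : nat) : int :=
  \sum_(z <- s) z.1 * (z.2.1 == n)%:Z.
Definition tail_coef (s : combination) (n : nat) : int :=
  \sum_(z <- s) z.1 * (n \in z.2.2)%:Z.
Definition coef (s : combination) (n : nat) : int :=
  (level n)%:Z * head_coef s n - tail_coef s n.

Lemma sum_indicator (V : nmodType) (F : nat -> V) (t : seq nat) (N : nat) :
  uniq t -> {in t, forall n, n < N}%N ->
  \sum_(a <- t) F a = \sum_(n < N) F n *+ (val n \in t).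
Proof.
elim: t => [_ _|a t IHt /= /andP[at_ ut] tN].
  by rewrite big_nil big1.
have aN : (a < N)%N by apply: tN; rewrite mem_head.
rewrite big_cons IHt//; last by move=> n nt; apply: tN; rewrite inE nt orbT.
rewrite (bigD1 (Ordinal aN))//= [in RHS](bigD1 (Ordinal aN))//=.
rewrite mem_head (negPf at_) mulr0n add0r mulr1n; congr (_ + _).
by apply: eq_bigr => n; rewrite -val_eqE /= inE => /negPf->.
Qed.

Definition combination_bound (s : combination) (N : nat) :=
  {in s, forall z, z.2.1 < N /\ {in z.2.2, forall n, n < N}}%N.

Lemma combination_bound_ex (s : combination) : exists N, combination_bound s N.
Proof.
exists (\max_(z <- s) maxn z.2.1 (\max_(a <- z.2.2) a)).+1 => z zs.
have := leq_bigmax_seq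
  (F := fun z => maxn z.2.1 (\max_(a <- z.2.2) a)) z zs isT.
rewrite geq_max => /andP[h1 h2]; split=> // a az; rewrite ltnS.
exact: leq_trans (leq_bigmax_seq a az isT) h2.
Qed.

Lemma coef_bound s N n : combination_bound s N -> (N <= n)%N -> coef s n = 0.
Proof.
move=> sN Nn; rewrite /coef /head_coef /tail_coef !big_seq.
rewrite !big1 ?mulr0 ?subr0//.
  move=> z /sN[_ zN]; case: (boolP (n \in _)) => [/zN|]; last by rewrite mulr0.
  by rewrite ltnNge Nn.
move=> z /sN[zN _]; case: eqP zN => [->|_]; last by rewrite mulr0.
by rewrite ltnNge Nn.
Qed.

Lemma combination_eltE s N : combination_valid s -> combination_bound s N ->
  combination_elt s =
    x *~ (\sum_(z <- s) z.1) + \sum_(n < N) spike n *~ coef s n.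
Proof.
move=> /allP vs sN; rewrite mulrz_sumr.
under [X in _ = _ + X]eq_bigr do
  rewrite /coef /head_coef /tail_coef mulr_sumr -sumrB mulrz_sumr.
rewrite exchange_big -big_split /= /combination_elt !big_seq.
apply: eq_bigr => z zs; have [zN tN] := sN z zs.
have /and4P[_ uz _ _] := vs z zs.
rewrite /relator_elt (sum_indicator spike uz tN) mulrzBl mulrzDl -addrA.
congr (_ + _).
have -> : spike z.2.1 *+ level z.2.1 =
    \sum_(n < N) (spike n *+ level n) *+ (val n \in [:: z.2.1]).
  rewrite -(sum_indicator (fun n => spike n *+ level n)) ?big_seq1//.
  by move=> n /[1!inE]/eqP->.
rewrite !mulrz_suml -sumrB; apply: eq_bigr => n _.
rewrite mulrzBr !pmulrn -!mulrzA inE eq_sym; congr (_ *~ _ - _ *~ _); ring.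
Qed.

Definition mass (s : combination) (l : nat) : nat :=
  \sum_(z <- s | level z.2.1 == l) `|z.1|%N.

(** Each unit of coefficient at level l costs 1/l. *)
Lemma mass_lt (s : combination) r l : cost s < 2^-1 ^+ r -> (0 < l)%N ->
  (mass s l * 2 ^ r < l)%N.
Proof.
move=> cs l0.
have : (mass s l)%:R / l%:R <= cost s.
  rewrite /mass natr_sum mulr_suml /cost big_mkcond /= ler_sum// => z _.
  case: eqP => [->|_]; first by rewrite -[in leRHS]natr_absz.
  by rewrite divr_ge0// ler0z.
move=> /le_lt_trans/(_ cs); rewrite ltr_pdivrMr ?ltr0n// mulrC exprVn.
by rewrite ltr_pdivlMr ?exprn_gt0// -natrX -natrM ltr_nat.
Qed.

Lemma head_coef_level s n : combination_valid s -> level n = 0%N ->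
  head_coef s n = 0.
Proof.
move=> /allP vs n0; rewrite /head_coef big_seq big1// => z /vs/and4P[z0 _ _ _].
by case: eqP z0 => [->|]; rewrite ?n0// mulr0.
Qed.

(** An index occurs only in relators of its own level, and at most once among
    the a_i; so both of its total coefficients are bounded by the mass of that
    level. *)
Lemma indicator_sum_le (s : combination) (l : nat) (P : relator -> bool) :
  {in s, forall z, P z.2 -> level z.2.1 = l} ->
  (`|(\sum_(z <- s) z.1 * (P z.2)%:Z)%R| <= mass s l)%N.
Proof.
move=> Pl; rewrite /mass big_seq big_mkcond.
rewrite [leqRHS]big_seq_cond [leqRHS]big_mkcond.
apply: (big_ind2 (fun (a : int) (b : nat) => (`|a| <= b)%N)) => //
  [a b c d ab cd|z _].
  rewrite -lez_nat PoszD abszE (le_trans (ler_normD _ _))//.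
  by rewrite lerD// -abszE lez_nat.
case: (boolP (z \in s)) => //= zs; case: (boolP (P z.2)) => [/(Pl z zs)->|_].
  by rewrite eqxx mulr1.
by rewrite mulr0.
Qed.

Lemma head_coef_le s n : (`|head_coef s n| <= mass s (level n))%N.
Proof.
by apply: (@indicator_sum_le s _ (fun j => j.1 == n)) => z _ /eqP->.
Qed.

Lemma tail_coef_le s n : combination_valid s ->
  (`|tail_coef s n| <= mass s (level n))%N.
Proof.
move=> /allP vs; apply: (@indicator_sum_le s _ (fun j => n \in j.2)) => z zs.
by have /and4P[_ _ _ /allP zl] := vs z zs => /zl/eqP.
Qed.

Lemma mass0 s : combination_valid s -> mass s 0 = 0%N.
Proof.
move=> /allP vs; rewrite /mass big_seq_cond big1// => z /andP[/vs/andP[z0 _]].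
by rewrite -[_ == _]negbK -lt0n z0.
Qed.

Lemma spike_torsion i e : (height i <= e)%N -> spike i *+ p ^ e = 0.
Proof.
move=> ie; rewrite pmulrn; apply/prufer_gen_eq0.
by rewrite dvdzE/= dvdn_exp2l.
Qed.

Lemma height_gap m :
  (0 < m)%N -> (m ^ 2 * p ^ ((m + k).-1 ^ 2) <= p ^ height m)%N.
Proof.
move=> m0; have -> : height m = (2 * m + (2 * k).-1 + (m + k).-1 ^ 2)%N.
  rewrite /height; case: k k_gt0 => // k' _; rewrite addnS /= -!mulnn; lia.
rewrite expnD leq_mul// expnD mulnC expnM.
apply: (@leq_trans ((p ^ m) ^ 2)); first by rewrite leq_sqr ltnW// ltn_expl.
by rewrite -expnM mulnC -expnM leq_pmull// expn_gt0 ltnW.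
Qed.

(** Otherwise let m be the largest index with a nonzero coefficient. Multiplying
    by p ^ e, where e is the square before [height m], kills x, the element
    itself and every g_i with i < m, and leaves c p ^ e g_m = 0 with c the
    coefficient of g_m; but c is less than m ^ 2 in absolute value, too small to
    be a multiple of the order of p ^ e g_m. *)
Lemma coef_eq0 s r n : combination_valid s -> cost s < 2^-1 ^+ r ->
  combination_elt s *+ p ^ r = 0 -> coef s n = 0.
Proof.
move=> vs cs sr; have [N sN] := combination_bound_ex s.
apply/eqP; apply: contraT => cn.
have [m cm mmax] : exists2 m, coef s m != 0 &
    forall i, (m < i)%N -> coef s i = 0.
  have ubP i : coef s i != 0 -> (i <= N)%N.
    by apply: contraNT; rewrite -ltnNge => /ltnW/(coef_bound sN)->.
  case: (ex_maxnP (ex_intro _ n cn) ubP) => m cm mmax; exists m => // i mi.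
  by apply/eqP; apply: contraTT mi => /mmax; rewrite -leqNgt.
have cm_le : (`|coef s m| <= (level m).+1 * mass s (level m))%N.
  rewrite -lez_nat abszE /coef (le_trans (ler_normB _ _))//.
  rewrite mulSn addnC PoszD lerD//; last by rewrite -abszE lez_nat tail_coef_le.
  by rewrite normrM PoszM ler_wpM2l// -abszE lez_nat head_coef_le.
have mass_gt0 : (0 < mass s (level m))%N.
  by move: cm_le; case: mass => //; rewrite muln0 leqn0 absz_eq0 (negPf cm).
have l_gt0 : (0 < level m)%N.
  by move: mass_gt0; case: level => //; rewrite mass0.
have mass_r := mass_lt cs l_gt0.
have lm := level_le m.
(* Some relator of this level occurs, at a cost of at least 1 / level m; as the
   total cost is less than 2 ^ -r, this gives r < 2 ^ r < level m <= m. *)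
have r_m : (r < m)%N.
  have := ltn_expl r (isT : 1 < 2)%N; nia.
have cm_lt : (`|coef s m| < m ^ 2)%N.
  have : (0 < 2 ^ r)%N by rewrite expn_gt0.
  move: (2 ^ r)%N mass_r => e; rewrite -mulnn; nia.
pose e := ((m + k).-1 ^ 2)%N.
have e_ge i : (i <= (m + k).-1)%N -> (i <= e)%N.
  by move=> ie; rewrite /e -mulnn; nia.
have : spike m *~ (coef s m * (p ^ e)%N) = 0.
  have mN : (m < N)%N.
    by rewrite ltnNge; apply: contraNN cm => /(coef_bound sN)->.
  have : combination_elt s *+ p ^ e = 0.
    rewrite -(@subnKC r e) ?e_ge//; last by lia.
    by rewrite expnD mulrnA sr mul0rn.
  rewrite (combination_eltE vs sN) mulrnDl pmulrn mulrzAC -pmulrn.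
  have -> : x *+ p ^ e = 0.
    rewrite -(@subnKC k e) ?e_ge//; last by lia.
    by rewrite expnD mulrnA xk mul0rn.
  rewrite mul0rz add0r -sumrMnl (bigD1 (Ordinal mN))//= big1 => [|i im].
    by rewrite addr0 pmulrn mulrzA.
  have [mi|im'] := ltnP m i; first by rewrite mmax// mulr0z mul0rn.
  have i_lt : (i < m)%N by rewrite ltn_neqAle im' andbT.
  rewrite pmulrn mulrzAC -pmulrn spike_torsion ?mul0rz//.
  by rewrite /height /e leq_sqr; lia.
move=> /prufer_gen_eq0; rewrite dvdzE abszM /= => /dvdn_leq.
have q0 : (0 < p ^ e)%N by rewrite expn_gt0 ltnW.
rewrite muln_gt0 absz_gt0 cm q0 => /(_ isT).
rewrite leqNgt (leq_trans _ (height_gap _))// ?ltn_pmul2r//.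
exact: leq_ltn_trans r_m.
Qed.

(** By [coef_eq0], for n of level l the integer [l * head_coef s n] equals
    [tail_coef s n], which is less than l in absolute value; so all the
    [head_coef s n] vanish. They add up to the sum of all coefficients, the
    multiple of x that occurs in the combination. *)
Lemma combination_elt_eq0 s r : combination_valid s -> cost s < 2^-1 ^+ r ->
  combination_elt s *+ p ^ r = 0 -> combination_elt s = 0.
Proof.
move=> vs cs sr; have [N sN] := combination_bound_ex s.
have c0 n : coef s n = 0 := coef_eq0 n vs cs sr.
have head0 n : head_coef s n = 0.
  have [l0|l_gt0] := posnP (level n); first exact: head_coef_level.
  apply/eqP; rewrite -absz_eq0; apply: contraT; rewrite -lt0n => h0.
  have := mass_lt cs l_gt0; have := tail_coef_le n vs.
  move/eqP: (c0 n); rewrite /coef subr_eq0 => /eqP/(congr1 absz).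
  rewrite abszM /=; have := expn_gt0 2 r; nia.
rewrite (combination_eltE vs sN) [X in _ + X]big1 => [|n _]; last first.
  by rewrite c0 mulr0z.
rewrite addr0; suff -> : \sum_(z <- s) z.1 = \sum_(n < N) head_coef s n.
  by rewrite big1 ?mulr0z.
rewrite exchange_big /= !big_seq; apply: eq_bigr => z zs.
have [zN _] := sN z zs.
rewrite -mulr_sumr (bigD1 (Ordinal zN))//= eqxx big1 ?addr0 ?mulr1// => i.
by rewrite -val_eqE /= eq_sym => /negPf->.
Qed.

Lemma cost_ball_hausdorff v : (forall r, cost_ball r v) -> v = 0.
Proof.
move=> vU; have [r vr] := prufer_torsion v.
have [s [vs cs vE]] := vU r.
by move: vr; rewrite vE => /(combination_elt_eq0 vs cs).
Qed.

End Combinatorics.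

(** * Continuous images of the topology and the theorem *)

Section Radical.
Local Open Scope ring_scope.
Variables (R : realType) (p : nat) (p_prime : prime p).
Variables (x : prufer p) (k : nat).
Hypotheses (xk : x *+ p ^ k = 0) (k_gt0 : (0 < k)%N).

Let p_gt1 : (1 < p)%N. Proof. exact: prime_gt1. Qed.

Definition radical_group : topologicalGroupType :=
  topologized_group (base_group_topology (cost_ball_base R p_prime x k)).

Local Notation chi := (@circle_char R p k).
Local Notation g := (spike p_prime k).

(** The bound is chosen so that the 2 l terms g_n of a relator of level l
    contribute 1/l in total. *)
Lemma char_spike n : (0 < level n)%N ->
  exists2 t : R, `|t| <= 2^-1 / (level n)%:R ^+ 2 &
    chi (g n) = \pi_(circle R) t.
Proof.
move=> ln; exists (p%:R ^+ k / p%:R ^+ height k n); last exact: circle_char_gen.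
have h_ge : (k + (2 * n).+1 <= height k n)%N.
  have := level_le n; rewrite /height -mulnn; nia.
have p0 : (0 : R) < p%:R by rewrite ltr0n ltnW.
rewrite ger0_norm; last by rewrite divr_ge0// exprn_ge0// ltW.
rewrite ler_pdivrMr ?exprn_gt0// mulrAC ler_pdivlMr ?exprn_gt0 ?ltr0n//.
rewrite ler_pdivlMl ?ltr0n// -!natrX -!natrM ler_nat.
apply: leq_trans (leq_pexp2l (ltnW p_gt1) h_ge).
rewrite expnD mulnCA leq_mul2l; apply/orP; right.
rewrite [leqRHS]expnS leq_mul// mulnC expnM leq_sqr.
by rewrite (leq_trans (level_le n))// ltnW// ltn_expl.
Qed.

Lemma char_relator (j : relator) : relator_valid j ->
  exists2 t : R, `|t| <= (level j.1)%:R^-1 &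
    chi (relator_elt p_prime x k j) = \pi_(circle R) t.
Proof.
move=> /and4P[l0 uj /eqP sj /allP lj].
have l0R : 0 < (level j.1)%:R :> R by rewrite ltr0n.
have [t tl tE] := char_spike l0.
have [s sl sE] : exists2 s : R,
    `|s| <= (size j.2)%:R * (2^-1 / (level j.1)%:R ^+ 2) &
    chi (\sum_(a <- j.2) g a) = \pi_(circle R) s.
  elim: (j.2) lj => [_|a A IHA /= lA].
    by exists 0; rewrite ?normr0 ?mul0r// big_nil !raddf0.
  have [|s sl sE] := IHA; first by move=> b bA; apply: lA; rewrite inE bA orbT.
  have /eqP la := lA a (mem_head _ _).
  have [|u ul uE] := @char_spike a; first by rewrite la.
  exists (u + s); last by rewrite big_cons raddfD /= uE sE quot_piD.
  rewrite (le_trans (ler_normD _ _))// -natr1 mulrDl addrC lerD// mul1r.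
  by rewrite -la.
exists (t *+ level j.1 - s).
  rewrite (le_trans (ler_normB _ _))// normrMn.
  apply: (@le_trans _ _ ((2^-1 / (level j.1)%:R ^+ 2) *+ level j.1 +
      (2^-1 / (level j.1)%:R ^+ 2) *+ level j.1)).
    apply: lerD; first by rewrite lerMn2r tl orbT.
    by rewrite -[leRHS]mulr_natl -[X in X%:R * _]sj.
  rewrite -mulr_natl le_eqVlt; apply/orP; left; apply/eqP; field.
  by rewrite gt_eqF.
rewrite /relator_elt raddfB raddfD raddfMn /= sE tE.
rewrite (circle_char_eq0 _ _ _).2// add0r.
by rewrite raddfB raddfMn.
Qed.

Lemma char_combination s : combination_valid s ->
  exists2 t : R, `|t| <= cost R s &
    chi (combination_elt p_prime x k s) = \pi_(circle R) t.
Proof.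
rewrite /combination_elt /cost; elim: s => [_|z s IHs /= /andP[vz vs]].
  by exists 0; rewrite ?big_nil ?normr0// !raddf0.
have [t ts tE] := IHs vs; have [u uz uE] := char_relator vz.
exists (u *~ z.1 + t).
  rewrite big_cons (le_trans (ler_normD _ _))// lerD// normrMz mulrC.
  by rewrite -mulrzl intr_norm mulrC ler_wpM2l.
by rewrite big_cons raddfD raddfMz /= uE tE quot_piD raddfMz.
Qed.

Lemma char_continuous_hom :
  @continuous_hom radical_group (circle_group R) chi.
Proof.
apply: base_continuous_hom; first exact: circle_charD.
move=> n; exists n => _ [s [vs cs ->]].
by have [t ts ->] := char_combination vs; exists t => //; exact: le_lt_trans cs.
Qed.

Section CompactImage.
Variables (K : topologicalGroupType) (f : radical_group -> K).
Hypotheses (cK : compact_hausdorff K) (hf : continuous_hom f).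

Lemma level_cluster (l : nat) : exists y : K, forall A, nbhs y A ->
  forall N, exists n, [/\ (N <= n)%N, level n = l & A (f (g n))].
Proof.
(* The indices of level l. *)
pose h m := (2 ^ l * (2 * m).+1)%N.
have [y [_ yc]] := cK.1 ((fun m => f (g (h m))) @ \oo) _ filterT.
exists y => A Ay N.
have [|_ [[m Nm <-] Am]] :=
    yc ((fun m => f (g (h m))) @` [set m | (N <= m)%N]) A _ Ay.
  by exists N => // m /= Nm; exists m.
exists (h m); split=> //.
  rewrite (leq_trans Nm)// /h; have : (0 < 2 ^ l)%N by rewrite expn_gt0.
  nia.
by rewrite /level /h lognM ?expn_gt0// pfactorK// lognE /= dvdn2 /= oddM addn0.
Qed.

Let fD (a b : prufer p) : f (a + b) = (f a * f b)%g.
Proof. by have [fM _] := hf; exact: fM. Qed.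

Let fB (a b : prufer p) : f (a - b) = (f a / f b)%g.
Proof. by rewrite fD; congr (_ * _)%g; exact: (continuous_homV hf). Qed.

Let fMn (a : prufer p) n : f (a *+ n) = (f a ^+ n)%g.
Proof.
elim: n => [|n IHn]; first exact: (continuous_hom1 hf).
by rewrite mulrSr fD IHn expgSr.
Qed.

(** The images of g_n with n of level l accumulate at a point y; choosing b and
    then the indices a_i one after the other, far enough to be distinct, brings
    the image of the relator near f x y^l y^-l. *)
Lemma compact_image_relator l (A : set K) : (0 < l)%N -> nbhs (f x) A ->
  exists j, [/\ relator_valid j, level j.1 = l &
    A (f (relator_elt p_prime x k j))].
Proof.
move=> l0 xA; have [y yl] := level_cluster l.
have [fM fc] := hf.
suff [j [lj uj sj lA Aj]] : exists j, [/\ level j.1 = l, uniq j.2, size j.2 = l,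
    all (fun a => level a == l) j.2 & A (f (relator_elt p_prime x k j))].
  by exists j; split=> //; rewrite /relator_valid lj l0 uj sj eqxx.
have step m : forall B : set K, nbhs (f x * y ^+ l * y^-1 ^+ m)%g B ->
    exists j, [/\ level j.1 = l, uniq j.2, size j.2 = m,
      all (fun a => level a == l) j.2 & B (f (relator_elt p_prime x k j))].
  elim: m => [|m IHm] B.
    rewrite expg0 mulg1 => yB.
    have cB : (fun u => f x * u ^+ l)%g @ y --> (f x * y ^+ l)%g.
      apply: cvg_mulg; first exact: cvg_cst.
      by apply: (@cvg_expg _ _ (nbhs y) id); exact: cvg_id.
    have [n [_ nl Bn]] := yl _ (cB _ yB) 0%N.
    exists (n, [::]); split=> //.
    by rewrite /relator_elt big_nil subr0 fD fMn /= nl.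
  rewrite expgSr mulgA => yB.
  pose w := (f x * y ^+ l * y^-1 ^+ m)%g.
  have cB : (fun z : K * K => z.1 / z.2)%g @ filter_prod (nbhs w) (nbhs y)
      --> (w / y)%g.
    apply: cvg_mulg; first exact: cvg_fst.
    by apply: (@cvg_invg _ _ _ snd); exact: cvg_snd.
  have [[B1 B2] /= [wB1 yB2] B12] := cB _ yB.
  have [[b A'] [/= bl uA sA lA B1A]] := IHm _ wB1.
  have [n [An nl B2n]] := yl _ yB2 (\max_(a <- A') a).+1.
  exists (b, n :: A'); split=> //=.
  - rewrite uA andbT; apply/negP => nA.
    by move: An; rewrite ltnNge (leq_bigmax_seq n nA).
  - by rewrite sA.
  - by rewrite nl eqxx.
  - have -> : relator_elt p_prime x k (b, n :: A') =
        relator_elt p_prime x k (b, A') - g n.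
      by rewrite /relator_elt /= big_cons opprD addrA addrAC.
    by rewrite fB; exact: (B12 (f _, f _)).
by apply: step; rewrite -mulgA expVgn mulgV mulg1.
Qed.

(** The image of a relator of large level is close both to 1 and to f x. *)
Lemma compact_image_radical : f x = 1%g.
Proof.
have [fM fc] := hf.
apply/esym/cK.2 => A B A1 Bx.
have /base_nbhsP[r rA] : nbhs (0 : radical_group) (f @^-1` A).
  by apply: fc; rewrite (continuous_hom1 hf).
have l_gt0 : (0 < 2 ^ r.+1)%N by rewrite expn_gt0.
have [j [vj lj Bj]] := compact_image_relator l_gt0 Bx.
exists (f (relator_elt p_prime x k j)); split=> //.
rewrite -[relator_elt _ _ _ _]add0r; apply: rA.
exists [:: (1, j)]; split.
- by rewrite /combination_valid /= vj.
- rewrite /cost big_seq1 /= normr1 lj mul1r natrX exprVn.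
  rewrite ltf_pV2 ?posrE ?exprn_gt0//.
  by rewrite ltr_eXn2l// ltr1n.
- by rewrite /combination_elt big_seq1 /= mulr1z.
Qed.

Lemma compact_image_cyclic (z : int) : f (x *~ z) = 1%g.
Proof.
have fx n : f (x *+ n) = 1%g by rewrite fMn compact_image_radical expg1n.
case: z => n; first exact: fx.
by rewrite -[_ *~ _]sub0r fB fx -[0](mulr0n x) fx divg1.
Qed.

End CompactImage.

End Radical.

Theorem theoremB (p : nat) (hp : prime p) (x : prufer p) (hx : x <> 0%R) :
  exists tau : group_topology (Algebra.to_multiplicative (prufer p)),
    hausdorff_space (topologized_group tau) /\
    von_neumann_radical (topologized_group tau) = cyclic_subgroup x.
Proof.
have xtor : exists k, (x *+ p ^ k == 0)%R.
  by have [k xk] := prufer_torsion x; exists k; apply/eqP.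
case: (ex_minnP xtor) => k /eqP xk k_min.
have k_gt0 : (0 < k)%N.
  rewrite lt0n; apply: contra_not_neq hx => k0.
  by rewrite -(mulr1n x) -[1%N](expn0 p) -k0.
have xk1 : (x *+ p ^ k.-1 != 0)%R.
  by apply: contraTneq k_gt0 => /eqP/k_min; rewrite -leqNgt; lia.
exists (base_group_topology (cost_ball_base Rdefinitions.R hp x k)).
split.
  by apply: base_hausdorff => a; exact: cost_ball_hausdorff.
rewrite (prufer_cyclic_subgroup hp xk xk1).
pose G := radical_group Rdefinitions.R hp x k.
apply/seteqP; split=> a.
  move=> /(_ _ _ (bohr_compactificationP G)) rho_a.
  have [_ _ univ] := bohr_compactificationP G.
  have cT : compact_hausdorff (circle_group Rdefinitions.R).
    by split; [exact: circle_compact|exact: circle_hausdorff].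
  have [h [[hh hE] _]] := univ _ _ cT (char_continuous_hom _ hp xk k_gt0).
  apply/(@circle_char_eq0 Rdefinitions.R).
  have <- : (h \o @bohr_point G) a = circle_char Rdefinitions.R k a.
    by rewrite hE.
  by rewrite /= rho_a; exact: (continuous_hom1 hh).
rewrite -(prufer_cyclic_subgroup hp xk xk1) => -[z _ <-] B rho [cB hrho _].
exact: compact_image_cyclic cB hrho z.
Qed.
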